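(* For $1<\alpha\le 2$, the Jacobian $J_\alpha(s)$ of the $\alpha$-Entmax mapping satisfies $$\sup_{s}\|J_\alpha(s)\|_2\le 1.$$
   Context: The $\alpha$-Entmax mapping is $\hat p_i(s)=\big((\alpha-1)(s_i-\tau(s))_+\big)^{1/(\alpha-1)}$ for $s\in\mathbb R^C$, where $(t)_+=\max\{t,0\}$ and $\tau(s)\in\mathbb R$ is the threshold with $\sum_{i=1}^C\hat p_i(s)=1$. Its Jacobian is $J_\alpha(s)=\nabla_s\hat p(s)$; within a region of fixed support $\mathcal P=\{i:\hat p_i(s)>0\}$, its $\mathcal P\times\mathcal P$ block is $\mathrm{diag}(a)-aa^\top/S_a$ with $a_i=\hat p_i(s)^{2-\alpha}$ for $i\in\mathcal P$ and $S_a=\sum_{i\in\mathcal P}a_i$, and the Jacobian vanishes outside the support. $\|\cdot\|_2$ is the spectral norm.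
   Formalization: The supremum is taken over those s at which the α-Entmax mapping is differentiable: this is every s when 1<α<2, but for α=2 the Jacobian does not exist at points where some s_i equals the threshold τ(s) (C≥2), for example s=(1,0). *)

(* Defs.v *)
From HB Require Import structures.
From mathcomp Require Import all_boot all_order all_algebra.
From mathcomp Require Import all_classical all_reals all_analysis.
Set Implicit Arguments.
Unset Strict Implicit.
Unset Printing Implicit Defensive.
Import Order.TTheory GRing.Theory Num.Theory.
Import numFieldNormedType.Exports.
Local Open Scope classical_set_scope.
Local Open Scope ring_scope.

Definition entmax_at (R : realType) (C : nat) (alpha : R) (s : 'rV[R]_C)
    (t : R) (i : 'I_C) : R :=
  ((alpha - 1) * Num.max (s 0 i - t) 0) `^ (alpha - 1)^-1.

(* For 0 < C and 1 < alpha there is exactly one such threshold: as a function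
   of t the sum is continuous, tends to +oo at -oo, and is strictly decreasing
   until it reaches 0, where it stays.  The default value of xget is therefore
   not used. *)
Definition entmax_threshold (R : realType) (C : nat) (alpha : R)
    (s : 'rV[R]_C) : R :=
  xget 0 [set t | \sum_(i < C) entmax_at alpha s t i = 1].

Definition entmax (R : realType) (C : nat) (alpha : R) (s : 'rV[R]_C) :
    'rV[R]_C :=
  \row_i entmax_at alpha s (entmax_threshold alpha s) i.

(* The library's 'J f s acts on row vectors from the right, so its (j, i) entry
   is the derivative of the i-th component along the j-th coordinate; the
   transpose restores the usual convention. *)
Definition entmax_jacobian (R : realType) (C : nat) (alpha : R)
    (s : 'rV[R]_C) : 'M[R]_C :=
  ('J (@entmax R C alpha) s)^T.

(* The library norm `|x| on matrices is the sup norm, hence this definition. *)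
Definition euclidean_norm (R : realType) (n : nat) (x : 'cV[R]_n) : R :=
  Num.sqrt (\sum_(i < n) x i 0 ^+ 2).

Definition spectral_norm (R : realType) (m n : nat) (A : 'M[R]_(m, n)) : R :=
  sup [set euclidean_norm (A *m x) | x in [set x | euclidean_norm x <= 1]].

(* Main.v *)
(* The gradient map [p |-> p^(alpha-1)/(alpha-1)] of the Tsallis negentropy is
   expanding on [0,1], because its derivative [p^(alpha-2)] is at least [1]
   there when [alpha <= 2].  The optimality condition
   [<s - grad(p), q - p> <= 0] for all [q] in the simplex, applied at two
   points, then makes Entmax 1-Lipschitz for the Euclidean norm, and so bounds
   every directional derivative, without computing the Jacobian. *)
Require Import Defs.
From HB Require Import structures.
From mathcomp Require Import all_boot all_order all_algebra.
From mathcomp Require Import all_classical all_reals all_analysis.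
From mathcomp Require Import ring lra.
Import Order.TTheory GRing.Theory Num.Theory.
Import numFieldNormedType.Exports.
Local Open Scope classical_set_scope.
Local Open Scope ring_scope.

(** Convexity of the power: the tangent at [u] lies below the graph. It follows from Young's
    inequality for [v] and [u^(r-1)], whose conjugate exponent [r/(r-1)] forces [r = 1] to be
    treated apart. *)
Lemma powR_sub_le_tangent (R : realType) (r u v : R) :
  1 <= r -> 0 <= u -> 0 <= v ->
  u `^ r - v `^ r <= r * u `^ (r - 1) * (u - v).
Proof.
rewrite le_eqVlt => /predU1P[<-|r1] u0 v0.
  by rewrite subrr powRr0 !powRr1// !mul1r.
have rB1 : 0 < r - 1 by rewrite subr_gt0.
have r0 : 0 < r by apply: lt_trans r1.
have rn0 := lt0r_neq0 r0; have rBn0 := lt0r_neq0 rB1.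
have := @conjugate_powR R v (u `^ (r - 1)) r (r / (r - 1)) v0 (powR_ge0 _ _) r0.
rewrite divr_gt0// => /(_ isT).
have -> : r^-1 + (r / (r - 1))^-1 = 1 by field; rewrite rn0 rBn0.
move=> /(_ erefl).
rewrite -powRrM (mulrC (r - 1)) divfK// => young.
have {}young : r * (v * u `^ (r - 1)) <= v `^ r + (r - 1) * u `^ r.
  rewrite mulrC -ler_pdivlMr//; apply: le_trans young _.
  rewrite [leLHS](_ : _ = (v `^ r + (r - 1) * u `^ r) / r)//.
  by field; rewrite rn0 rBn0.
have ur := mulr_powRB1 u0 r0.
have -> : r * u `^ (r - 1) * (u - v) = r * (u * u `^ (r - 1)) - r * (v * u `^ (r - 1)).
  by ring.
by rewrite ur; lra.
Qed.

(** With [r = b^-1], the map [x |-> (b x)^r] inverts the gradient map [p |-> p^b / b]; it is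
    nondecreasing, with slope [(b x)^(r-1) <= 1] as long as [b x <= 1]. *)
Lemma powR_inv_expanding (R : realType) (b x y : R) :
  0 < b -> 1 <= b^-1 -> 0 <= x -> 0 <= y -> b * x <= 1 -> b * y <= 1 ->
  ((b * x) `^ b^-1 - (b * y) `^ b^-1) ^+ 2
  <= (x - y) * ((b * x) `^ b^-1 - (b * y) `^ b^-1).
Proof.
move=> b0 b1; wlog yx : x y / y <= x.
  move=> W x0 y0 bx by_; have [yx|/ltW xy] := leP y x; first exact: W.
  by have := W y x xy y0 x0 by_ bx; lra.
move=> x0 y0 bx by_.
have bx0 : 0 <= b * x by rewrite mulr_ge0// ltW.
have by0 : 0 <= b * y by rewrite mulr_ge0// ltW.
rewrite expr2; apply: ler_wpM2r.
  by rewrite subr_ge0 ge0_ler_powR ?nnegrE ?invr_ge0 ?(ltW b0)// ler_wpM2l// ltW.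
(* The tangent is taken at the larger point [b * x]; its factor [b^-1] cancels the [b] of
   [b * (x - y)]. *)
apply: le_trans (powR_sub_le_tangent _ _ _ _ _ _ _) _ => //.
rewrite -mulrBr -mulrA mulrCA mulKf ?lt0r_neq0// mulrC ler_piMr ?subr_ge0//.
have c0 : 0 <= b^-1 - 1 by rewrite subr_ge0.
have := @ge0_ler_powR R (b^-1 - 1) c0 (b * x) 1.
by rewrite powR1 !nnegrE; apply.
Qed.

(** The limit [l] may be 0, as when a coordinate leaves the support. Tangents at both points give a
    Lipschitz bound near [l], hence a squeeze. *)
Lemma cvg_powR_ge1 (R : realType) (T : Type) (F : set_system T) (FF : Filter F)
    (f : T -> R) (l r : R) :
  1 <= r -> (forall x, 0 <= f x) -> 0 <= l ->
  f x @[x --> F] --> l -> f x `^ r @[x --> F] --> l `^ r.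
Proof.
move=> r1 f0 l0 fl.
(* Bounds the slope [r a^(r-1)] for [0 <= a <= l + 1]; the margin 1 makes [f x <= l + 1] hold
   eventually. *)
pose K := r * (l + 1) `^ (r - 1).
have r0 : 0 <= r by apply: le_trans r1.
have rB1 : 0 <= r - 1 by rewrite subr_ge0.
have tangentK a b : 0 <= a -> 0 <= b -> a <= l + 1 ->
    a `^ r - b `^ r <= K * `|a - b|.
  move=> a0 b0 al; apply: le_trans (powR_sub_le_tangent _ _ _ _ _ _ _) _ => //.
  have /le_trans : r * a `^ (r - 1) * (a - b) <= r * a `^ (r - 1) * `|a - b|.
    by rewrite ler_wpM2l ?mulr_ge0 ?powR_ge0// ler_norm.
  apply; rewrite ler_wpM2r// ler_wpM2l// ge0_ler_powR// nnegrE.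
  by rewrite addr_ge0.
have dist0 : K * `|f x - l| @[x --> F] --> 0.
  rewrite -(mulr0 K); apply: cvgMr; rewrite -[X in _ --> X](@normr0 _ R).
  by apply: cvg_norm; rewrite -(subrr l); apply: cvgB => //; apply: cvg_cst.
apply: (@squeeze_cvgr _ _ _ _ (fun x => l `^ r - K * `|f x - l|)
                              (fun x => l `^ r + K * `|f x - l|)).
- have l1 : l < l + 1 by rewrite ltrDl.
  move: (l1) => /(cvgr_le _ fl); apply: filterS => x fx1.
  have := tangentK (f x) l (f0 x) l0 fx1.
  have := tangentK l (f x) l0 (f0 x) (ltW l1).
  by rewrite distrC => ? ?; apply/andP; split; lra.
- by rewrite -[X in _ --> X]subr0; apply: cvgB => //; apply: cvg_cst.
- by rewrite -[X in _ --> X]addr0; apply: cvgD => //; apply: cvg_cst.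
Qed.

(** The Lipschitz bound holds for every difference quotient and passes to the limit because it
    defines a closed set. *)
Lemma sumsq_derive_le (R : realType) (m n : nat)
    (f : 'rV[R]_m -> 'rV[R]_n) (s v : 'rV[R]_m) :
  (forall x y, \sum_(i < n) (f x 0 i - f y 0 i) ^+ 2
               <= \sum_(i < m) (x 0 i - y 0 i) ^+ 2) ->
  derivable f s v ->
  \sum_(i < n) ('D_v f s) 0 i ^+ 2 <= \sum_(i < m) v 0 i ^+ 2.
Proof.
move=> f_lip df.
pose sumsq (w : 'rV[R]_n) := \sum_(i < n) w 0 i ^+ 2.
have sumsq_cont : continuous sumsq.
  apply: continuous_big => [|i _] w; first exact: add_continuous.
  exact: (@continuous_comp _ _ _ (fun w : 'rV[R]_n => w 0 i)
    (fun x : R => x ^+ 2) w (@coord_continuous R 1 n 0 i w)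
    (@exprn_continuous R 2 _)).
apply: (@closed_cvg _ _ (0 : R)^' _
  (fun h => h^-1 *: ((f \o shift s) (h *: v) - f s))
  (fun w => sumsq w <= \sum_(i < m) v 0 i ^+ 2)) df.
- exact: (preimage_closed (fun w _ => sumsq_cont w) (@closed_le R _)).
- near=> h.
  have h0 : h != 0 by near: h; exact: nbhs_dnbhs_neq.
  have -> : sumsq (h^-1 *: ((f \o shift s) (h *: v) - f s)) =
      h ^- 2 * \sum_(i < n) (f (h *: v + s) 0 i - f s 0 i) ^+ 2.
    by rewrite mulr_sumr; apply: eq_bigr => i _; rewrite !mxE exprMn exprVn.
  rewrite mulrC ler_pdivrMr ?exprn_even_gt0//.
  apply: le_trans (f_lip _ _) _; rewrite mulr_suml ler_sum// => i _.
  by rewrite !mxE addrK exprMn mulrC.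
Unshelve. all: by end_near.
Qed.

(** Here [x] and [y] are the gradients at the optimal points [p] and [q]. Adding the two optimality
    conditions, each tested at the other point, gives [<x - y, p - q> <= <s - s', p - q>]. *)
Lemma nonexpansive_of_optimality (R : realFieldType) (I : finType)
    (s s' x y p q : I -> R) :
  (forall i, (p i - q i) ^+ 2 <= (x i - y i) * (p i - q i)) ->
  \sum_i (s i - x i) * (q i - p i) <= 0 ->
  \sum_i (s' i - y i) * (p i - q i) <= 0 ->
  \sum_i (p i - q i) ^+ 2 <= \sum_i (s i - s' i) ^+ 2.
Proof.
move=> expanding opt opt'.
have expanding_sum : \sum_i (p i - q i) ^+ 2 <= \sum_i (x i - y i) * (p i - q i).
  exact: ler_sum.
(* From [|d|^2 <= <e, d>] and [2 <e, d> <= |e|^2 + |d|^2]. *)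
have young : 2 * \sum_i (s i - s' i) * (p i - q i)
    <= \sum_i (s i - s' i) ^+ 2 + \sum_i (p i - q i) ^+ 2.
  rewrite mulr_sumr -big_split/=; apply: ler_sum => i _.
  rewrite -subr_ge0; set e := s i - _; set d := p i - _.
  have -> : e ^+ 2 + d ^+ 2 - 2 * (e * d) = (e - d) ^+ 2 by ring.
  exact: sqr_ge0.
have split_sum : \sum_i (x i - y i) * (p i - q i) =
    \sum_i (s i - s' i) * (p i - q i)
    + \sum_i (s i - x i) * (q i - p i)
    + \sum_i (s' i - y i) * (p i - q i).
  by rewrite -!big_split; apply: eq_bigr => i _ /=; ring.
by move: expanding_sum; rewrite split_sum; lra.
Qed.

Section entmax.
Context (R : realType) (C : nat) (alpha : R).
Hypotheses (hC : (0 < C)%N) (h1 : 1 < alpha) (h2 : alpha <= 2).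
Implicit Types s : 'rV[R]_C.

Let beta_gt0 : 0 < alpha - 1. Proof. by rewrite subr_gt0. Qed.
Let beta_neq0 : alpha - 1 != 0. Proof. exact: lt0r_neq0. Qed.
Let r_ge1 : 1 <= (alpha - 1)^-1.
Proof. by rewrite invf_ge1 ?lerBlDr. Qed.

(** This is the gradient [p^(alpha-1)/(alpha-1)] at [p = entmax_at alpha s t i]; both vanish off the
    support. *)
Local Notation gap s t i := (Num.max (s 0 i - t) 0).

Lemma entmax_at_ge0 s t i : 0 <= entmax_at alpha s t i.
Proof. exact: powR_ge0. Qed.

Lemma entmax_at_continuous s i : continuous (fun t => entmax_at alpha s t i).
Proof.
move=> t; apply: cvg_powR_ge1 => //.
- by move=> x; rewrite mulr_ge0 ?(ltW beta_gt0)// le_max lexx orbT.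
- by rewrite mulr_ge0 ?(ltW beta_gt0)// le_max lexx orbT.
apply: cvgMr.
apply: (@continuous_max R R (fun t => s 0 i - t) (fun=> 0) t).
- by apply: cvgB; [exact: cvg_cst|exact: cvg_id].
- exact: cvg_cst.
Qed.

Lemma sum_entmax_at_threshold s :
  \sum_(i < C) entmax_at alpha s (entmax_threshold alpha s) i = 1.
Proof.
apply: (@xgetPex R 0 [set t | \sum_(i < C) entmax_at alpha s t i = 1]).
pose F t := \sum_(i < C) entmax_at alpha s t i.
have Fc : continuous F.
  apply: continuous_big => [|i _]; first exact: add_continuous.
  exact: entmax_at_continuous.
pose i0 := Ordinal hC.
(* Endpoints for the intermediate value theorem: at the largest score [b] every term is 0, while at
   [a] the term of [i0] alone is already 1. *)
pose b := \big[Num.max/s 0 i0]_(i < C) s 0 i.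
have sb i : s 0 i <= b by exact: le_bigmax.
pose a := s 0 i0 - (alpha - 1)^-1.
have Fb : F b = 0.
  apply: big1 => i _; rewrite /entmax_at max_r ?subr_le0// mulr0.
  by rewrite powR0// invr_neq0.
have Fa : 1 <= F a.
  rewrite /F (bigD1 i0)//= {1}/entmax_at /a subKr max_l ?invr_ge0 ?(ltW beta_gt0)//.
  by rewrite divff// powR1 lerDl sumr_ge0// => i _; exact: entmax_at_ge0.
have ab : a <= b.
  by apply: le_trans (sb i0); rewrite gerBl invr_ge0 ltW.
have [|t _ Ft] := @IVT R F a b 1 ab (continuous_subspaceT Fc).
  by rewrite Fb ge_min le_max Fa ler01 orbT.
by exists t.
Qed.

Let gap_ge0 s t i : 0 <= gap s t i.
Proof. by rewrite le_max lexx orbT. Qed.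

(** Keeps the base of the power in the range where the slope is at most 1: a base above 1 would give
    a weight above 1. *)
Let gap_le s t i :
  \sum_(j < C) entmax_at alpha s t j = 1 -> (alpha - 1) * gap s t i <= 1.
Proof.
move=> sum1; have p1 : entmax_at alpha s t i <= 1.
  rewrite -sum1 (bigD1 i)//= lerDl sumr_ge0// => j _; exact: entmax_at_ge0.
apply: contraLR p1; rewrite -!ltNge /entmax_at => u1.
exact: lt_le_trans u1 (le1r_powR (ltW u1) r_ge1).
Qed.

(** Since both points have total mass 1, [s] may be shifted by [t]. On the support the first factor
    is then 0; off it, that factor is nonpositive and the second is [q i >= 0]. *)
Lemma entmax_at_optimality s t (q : 'I_C -> R) :
  \sum_(i < C) entmax_at alpha s t i = 1 ->
  (forall i, 0 <= q i) -> \sum_(i < C) q i = 1 ->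
  \sum_(i < C) (s 0 i - gap s t i) * (q i - entmax_at alpha s t i) <= 0.
Proof.
move=> p1 q0 q1.
rewrite (eq_bigr (fun i => (s 0 i - t - gap s t i) * (q i - entmax_at alpha s t i)
                           + t * (q i - entmax_at alpha s t i))); last first.
  by move=> i _; ring.
rewrite big_split/= -mulr_sumr sumrB q1 p1 subrr mulr0 addr0.
apply: sumr_le0 => i _; rewrite /entmax_at.
have [ts|ts] := leP (s 0 i - t) 0.
  by rewrite mulr0 powR0 ?invr_neq0// !subr0 mulr_le0_ge0.
by rewrite subrr mul0r.
Qed.

Lemma entmax_at_lipschitz s t s' t' :
  \sum_(i < C) entmax_at alpha s t i = 1 ->
  \sum_(i < C) entmax_at alpha s' t' i = 1 ->
  \sum_(i < C) (entmax_at alpha s t i - entmax_at alpha s' t' i) ^+ 2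
  <= \sum_(i < C) (s 0 i - s' 0 i) ^+ 2.
Proof.
move=> sum1 sum1'.
have opt := entmax_at_optimality s t _ sum1 (entmax_at_ge0 s' t') sum1'.
have opt' := entmax_at_optimality s' t' _ sum1' (entmax_at_ge0 s t) sum1.
have expanding i :
    (entmax_at alpha s t i - entmax_at alpha s' t' i) ^+ 2
    <= (gap s t i - gap s' t' i) * (entmax_at alpha s t i - entmax_at alpha s' t' i).
  by apply: powR_inv_expanding => //; apply: gap_le.
exact: (@nonexpansive_of_optimality _ _ (s 0) (s' 0) (fun i => gap s t i)
  (fun i => gap s' t' i) (entmax_at alpha s t) (entmax_at alpha s' t')).
Qed.

Lemma entmax_lipschitz s s' :
  \sum_(i < C) (entmax alpha s 0 i - entmax alpha s' 0 i) ^+ 2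
  <= \sum_(i < C) (s 0 i - s' 0 i) ^+ 2.
Proof.
apply: le_trans (entmax_at_lipschitz _ _ _ _ (sum_entmax_at_threshold s)
  (sum_entmax_at_threshold s')).
by apply: ler_sum => i _; rewrite [X in X - _]mxE [X in _ - X]mxE.
Qed.

End entmax.

Theorem lemmaB8 (R : realType) (C : nat) (alpha : R)
    (hC : (0 < C)%N) (h1 : 1 < alpha) (h2 : alpha <= 2) :
  (ereal_sup [set (spectral_norm (entmax_jacobian alpha s))%:E
             | s in [set s : 'rV[R]_C | differentiable (@entmax R C alpha) s]]
   <= 1%:E)%E.
Proof.
apply: ge_ereal_sup => _ [s /= ds <-]; rewrite lee_fin.
apply: ge_sup.
  (* The supremum is over a nonempty set: the zero vector lies in the unit ball. *)
  exists (euclidean_norm (entmax_jacobian alpha s *m 0)), 0 => //=.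
  by rewrite /euclidean_norm big1 ?sqrtr0// => i _; rewrite mxE expr0n.
move=> _ [x /= x1 <-]; apply: le_trans x1; rewrite ler_wsqrtr//.
(* The derivative along [x^T] is the row [x^T *m 'J], the transpose of the column to be bounded. *)
have := sumsq_derive_le _ _ _ _ s x^T (entmax_lipschitz R C alpha hC h1 h2)
  (diff_derivable ds).
rewrite derivemxE// => H.
have -> : entmax_jacobian alpha s *m x = (x^T *m 'J (@entmax R C alpha) s)^T.
  by rewrite trmx_mul trmxK.
under eq_bigr do rewrite mxE.
by apply: le_trans H _; rewrite ler_sum// => i _; rewrite mxE.
Qed.
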